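(* The surface $(\mathbb{K},g_0)$, where $\mathbb{K}$ is a Klein bottle and $$g_0=\frac{9+(1+8\cos^2 v)^2}{1+8\cos^2 v}\left(du^2+\frac{dv^2}{1+8\cos^2 v}\right),\qquad 0\le u<\pi/2,\ 0\le v<\pi,$$ is a bipolar surface of Lawson's $\tau_{3,1}$-torus.
   Context: The Klein bottle: $\mathbb{K}$ is the quotient of the $(u,v)$-plane by the group generated by $(u,v)\mapsto(u,v+\pi)$ and $(u,v)\mapsto(u+\pi/2,\sigma(v))$. Here $\sigma:\mathbb{R}\to\mathbb{R}$ is the decreasing smooth involution with $\sigma(0)=\pi/2$, $\cos\sigma(v)=\dfrac{\sin v}{\sqrt{1+8\cos^2v}}$ and $\sin\sigma(v)=\dfrac{3\cos v}{\sqrt{1+8\cos^2 v}}$; the metric $g_0$ is invariant under this group. Equivalently, set $x=2u$ and $y=2z(v)+K(1/2)/2$, where $z(v)=\int_0^v\frac{ds}{\sqrt{1+8\cos^2 s}}$ and $K(k)=\int_0^{\pi/2}\frac{d\theta}{\sqrt{1-k^2\sin^2\theta}}$. Then $\mathbb{K}$ is the quotient of the $(x,y)$-plane by the group generated by $(x,y)\mapsto(x+\pi,-y)$ and $(x,y)\mapsto(x,y+2K(1/2))$. Lawson torus: for integers $m\ge k\ge1$, $\tau_{m,k}$ is the minimal torus in the unit sphere $\mathbb{S}^3\subset\mathbb{R}^4$ defined by the doubly periodic immersion $\mu:\mathbb{R}^2\to\mathbb{S}^3$, $$\mu(u,v)=(\cos mu\cos v,\ \sin mu\cos v,\ \cos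 ku\sin v,\ \sin ku\sin v).$$ Bipolar surface: let $\mu:M\to\mathbb{S}^3\subset\mathbb{R}^4$ be a minimal isometric immersion of a surface $M$. The Gauss map $\mu^*:M\to\mathbb{S}^3$ is defined pointwise as the unit normal to $M$ in $\mathbb{S}^3$ translated to the origin in $\mathbb{R}^4$. Put $\tilde\mu=\mu\wedge\mu^*$, a map $\tilde\mu:M\to\mathbb{S}^5\subset\wedge^2\mathbb{R}^4=\mathbb{R}^6$, which is a minimal immersion. The minimal surface $\tilde M=\tilde\mu(M)\subset\mathbb{S}^5$, with the induced metric, is called the bipolar surface to $M$. To say that a Riemannian surface is a bipolar surface of $M$ means that it is isometric to $\tilde M$. *)

(* Defs.v *)
From HB Require Import structures.
From Stdlib Require Import Relation_Operators.
From mathcomp Require Import all_boot all_order all_algebra.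
From mathcomp Require Import all_classical all_reals all_analysis.
From mathcomp Require Import ring lra.
Set Implicit Arguments.
Unset Strict Implicit.
Unset Printing Implicit Defensive.
Import Order.TTheory GRing.Theory Num.Theory.
Import numFieldNormedType.Exports.
Local Open Scope classical_set_scope.
Local Open Scope quotient_scope.
Local Open Scope ring_scope.

(* On a finite-dimensional V this is the usual class C^n: having continuous
   directional derivatives in all directions is the same as being C^1. *)
Fixpoint Ck (R : realType) (V W : normedModType R) (n : nat) (f : V -> W)
    : Prop :=
  continuous f /\
  if n is k.+1 then
    forall v : V, (forall x, derivable f x v) /\ Ck k (fun x => 'D_v f x)
  else True.

Definition smooth (R : realType) (V W : normedModType R) (f : V -> W) : Prop :=
  forall n, Ck n f.

Lemma CkS (R : realType) (V W : normedModType R) n (f : V -> W) :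
  Ck n.+1 f -> Ck n f.
Proof.
elim: n f => [|n IHn] f [cf df]; first by split.
by split=> // v; have [dv Dv] := df v; split=> //; exact: IHn.
Qed.

Lemma Ck_cst (R : realType) (V W : normedModType R) n (c : W) :
  Ck n (cst c : V -> W).
Proof.
elim: n c => [|n IHn] c; split=> //; try by move=> x; exact: cvg_cst.
move=> v; split; first by move=> x; exact: derivable_cst.
by under eq_fun do rewrite derive_cst; exact: IHn.
Qed.

Lemma CkD (R : realType) (V W : normedModType R) n (f g : V -> W) :
  Ck n f -> Ck n g -> Ck n (f \+ g).
Proof.
elim: n f g => [|n IHn] f g [cf df] [cg dg]; split=> //;
  try by move=> x; apply: continuousD; [exact: cf|exact: cg].
move=> v; have [dvf Dvf] := df v; have [dvg Dvg] := dg v.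
split=> [x|]; first exact: derivableD.
by under eq_fun do rewrite deriveD//; exact: IHn.
Qed.

Lemma CkM (R : realType) (V : normedModType R) n (f g : V -> R) :
  Ck n f -> Ck n g -> Ck n (f \* g).
Proof.
elim: n f g => [|n IHn] f g Cf Cg; have [cf df] := Cf; have [cg dg] := Cg;
  split=> //; try by move=> x; apply: continuousM; [exact: cf|exact: cg].
move=> v; have [dvf Dvf] := df v; have [dvg Dvg] := dg v.
split=> [x|]; first exact: derivableM.
under eq_fun do rewrite deriveM//.
by apply: CkD; apply: IHn => //; exact: CkS.
Qed.

Lemma CkV (R : realType) (V : normedModType R) n (f : V -> R) :
  (forall x, f x != 0) -> Ck n f -> Ck n (fun x => (f x)^-1).
Proof.
move=> f0; elim: n => [|n IHn] Cf; have [cf df] := Cf;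
  split=> //; try by move=> x; apply: continuousV; [|exact: cf].
move=> v; have [dvf Dvf] := df v.
split=> [x|]; first exact: derivableV.
have Cfi := IHn (CkS Cf).
have := CkM (CkM (@Ck_cst R V R n (-1)) (CkM Cfi Cfi)) Dvf.
congr (Ck n _); apply/funext => x /=.
by rewrite deriveV// mulN1r -invfM -expr2.
Qed.

Lemma Ck_is_derive (R : realType) (n : nat) (f df : R -> R) :
  (forall x : R, is_derive x 1 f (df x)) -> Ck n df -> Ck n.+1 f.
Proof.
move=> fdf Cdf.
have difff x : differentiable f x by apply/derivable1_diffP; exact: ex_derive.
split=> [x|v]; first exact: differentiable_continuous.
split=> [x|]; first exact: diff_derivable.
have -> : (fun x => 'D_v f x) = cst v \* df.
  apply/funext => x /=; have dx : derivable f x 1 by exact: ex_derive.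
  by rewrite deriveE// deriv1E// derive1E derive_val.
by apply: CkM => //; exact: Ck_cst.
Qed.

Lemma Ck_sin_cos (R : realType) n : Ck n (@sin R) /\ Ck n (@cos R).
Proof.
elim: n => [|n [IHs IHc]].
  by do 2!split=> //; [exact: continuous_sin|exact: continuous_cos].
split; first exact: Ck_is_derive IHc.
apply: (@Ck_is_derive _ _ _ (cst (-1) \* sin)).
  by move=> x; rewrite /= mulN1r; exact: is_derive_cos.
by apply: CkM => //; exact: Ck_cst.
Qed.

Definition dotv (R : realType) (n : nat) (x y : 'rV[R]_n) : R :=
  \sum_(i < n) x 0 i * y 0 i.

(* Coordinates of a /\ b in the basis e_i /\ e_j (i < j) of the exterior
   square of R^4, identified with Euclidean R^6 by declaring this basis
   orthonormal. *)
Definition wedge (R : realType) (a b : 'rV[R]_4) : 'rV[R]_6 :=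
  let pl i j : R :=
    a 0 (inord i) * b 0 (inord j) - a 0 (inord j) * b 0 (inord i) in
  \row_(k < 6)
    nth 0 [:: pl 0 1; pl 0 2; pl 0 3; pl 1 2; pl 1 3; pl 2 3]%N k.

Definition lawson (R : realType) (m k : nat) (p : R * R) : 'rV[R]_4 :=
  \row_(i < 4) nth 0
    [:: cos (m%:R * p.1) * cos p.2; sin (m%:R * p.1) * cos p.2;
        cos (k%:R * p.1) * sin p.2; sin (k%:R * p.1) * sin p.2] i.

(* A surface M immersed in the unit sphere of R^4 is given by mu : R^2 -> R^4;
   M is the quotient of the plane by the periods of mu, so that functions on M
   are the functions on the plane having these periods. A Gauss map is a
   (smooth) choice of unit normal to M in the sphere; it is unique up to sign
   for an immersion mu. *)
Definition is_gauss_map (R : realType) (mu nu : R * R -> 'rV[R]_4) : Prop :=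
  [/\ smooth nu,
      forall w : R * R, (forall p, mu (p + w) = mu p) ->
        forall p, nu (p + w) = nu p
    & forall p : R * R,
      [/\ dotv (nu p) (nu p) = 1, dotv (nu p) (mu p) = 0
        & forall X : R * R, dotv (nu p) ('D_X mu p) = 0]].

Definition bipolar_image (R : realType) (mu nu : R * R -> 'rV[R]_4)
    : set 'rV[R]_6 :=
  range (fun p : R * R => wedge (mu p) (nu p)).

(* Let the quotient Q of the plane be by a group acting freely and properly
   discontinuously by isometries of the Riemannian metric g, where g p is a
   bilinear form on R^2 = T_p R^2. Functions on Q are smooth when their lifts
   to the plane are, and the metric of Q is the one whose lift is g. An
   isometry of Q onto a surface S of R^n with the metric induced by the
   Euclidean one is then a smooth embedding F of Q with image S that pulls the
   Euclidean inner product back to g. *)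
Record is_isometry_onto (R : realType) (Q : quotType (R * R)%type)
    (g : R * R -> R * R -> R * R -> R) (n : nat) (S : set 'rV[R]_n)
    (F : Q -> 'rV[R]_n) : Prop := IsIsometryOnto {
  isometry_smooth : smooth (fun p : R * R => F (\pi_Q p));
  isometry_metric : forall p X Y : R * R,
    dotv ('D_X (fun p : R * R => F (\pi_Q p)) p)
         ('D_Y (fun p : R * R => F (\pi_Q p)) p) = g p X Y;
  isometry_inj : injective F;
  isometry_image : range F = S;
  isometry_open : forall U : set (quotient_topology Q), open U ->
    exists2 V : set 'rV[R]_n, open V & F @` U = S `&` V }.

(* The Riemannian surface (Q, g) is a bipolar surface of the surface M
   immersed by mu. The two Gauss maps of M give antipodal, hence isometric,
   images. *)
Definition is_bipolar_surface (R : realType) (Q : quotType (R * R)%type)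
    (g : R * R -> R * R -> R * R -> R) (mu : R * R -> 'rV[R]_4) : Prop :=
  exists2 nu : R * R -> 'rV[R]_4, is_gauss_map mu nu &
    exists F : Q -> 'rV[R]_6, is_isometry_onto g (bipolar_image mu nu) F.

Definition is_klein_sigma (R : realType) (sigma : R -> R) : Prop :=
  [/\ smooth sigma,
      (forall x y, x < y -> sigma y < sigma x),
      involutive sigma,
      sigma 0 = pi / 2
    & forall v,
      cos (sigma v) = sin v / Num.sqrt (1 + 8 * cos v ^+ 2) /\
      sin (sigma v) = 3 * cos v / Num.sqrt (1 + 8 * cos v ^+ 2)].

(* The witness is sigma v = pi/2 - v + atan (sin (2v) / (1 + 2 cos^2 v)). By
   continuity, is_klein_sigma has no other solution. *)
Lemma klein_sigma_exists (R : realType) : exists s : R -> R, is_klein_sigma s.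
Proof.
pose c (v : R) := cos v; pose s (v : R) := sin v.
have c2 v : s v ^+ 2 = 1 - c v ^+ 2 by rewrite /s sin2cos2.
have w0 v : 0 < 1 + 8 * c v ^+ 2 by have := sqr_ge0 (c v); lra.
have d0 v : 0 < 1 + 2 * c v ^+ 2 by have := sqr_ge0 (c v); lra.
pose t v := 2 * s v * c v / (1 + 2 * c v ^+ 2).
have t2 v : 1 + t v ^+ 2 = (1 + 8 * c v ^+ 2) / (1 + 2 * c v ^+ 2) ^+ 2.
  rewrite /t !exprMn exprVn c2; field.
  by rewrite lt0r_neq0.
pose sg v := pi / 2 - v + atan (t v).
pose w v := Num.sqrt (1 + 8 * c v ^+ 2).
have wp v : 0 < w v by rewrite sqrtr_gt0.
have w2 v : w v ^+ 2 = 1 + 8 * c v ^+ 2 by rewrite sqr_sqrtr// ltW.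
have cosat v : cos (atan (t v)) = (1 + 2 * c v ^+ 2) / w v.
  rewrite cos_atan t2 sqrtrM ?ltW// sqrtrV ?sqr_ge0//.
  by rewrite sqrtr_sqr gtr0_norm// invf_div.
have sinat v : sin (atan (t v)) = 2 * s v * c v / w v.
  have cn0 : cos (atan (t v)) != 0.
    by rewrite cosat mulf_neq0// ?invr_eq0 lt0r_neq0.
  have := atanK (t v); rewrite /tan => /(canRL (mulfVK cn0)) ->.
  by rewrite cosat /t; field; rewrite !lt0r_neq0.
have cosS v : cos (sg v) = s v / w v.
  have -> : sg v = pi / 2 - (v - atan (t v)) by rewrite /sg; ring.
  rewrite cosB cos_pihalf sin_pihalf mul0r add0r mul1r sinB cosat sinat.
  rewrite -/(s v) -/(c v).
  have -> : s v * ((1 + 2 * c v ^+ 2) / w v) - c v * (2 * s v * c v / w v)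
          = s v / w v by field; rewrite lt0r_neq0.
  by [].
have sinS v : sin (sg v) = 3 * c v / w v.
  have -> : sg v = pi / 2 - (v - atan (t v)) by rewrite /sg; ring.
  rewrite sinB cos_pihalf sin_pihalf mul0r subr0 mul1r cosB cosat sinat.
  rewrite -/(s v) -/(c v).
  have -> : c v * ((1 + 2 * c v ^+ 2) / w v) + s v * (2 * s v * c v / w v)
    = (c v * (1 + 2 * c v ^+ 2) + 2 * s v ^+ 2 * c v) / w v.
    by field; rewrite lt0r_neq0.
  by rewrite c2; field; rewrite lt0r_neq0.
have dsg (v : R) : is_derive v 1 sg (- 3 / (1 + 8 * c v ^+ 2)).
  have ds : is_derive v 1 s (c v) by exact: is_derive_sin.
  have dc : is_derive v 1 c (- s v) by exact: is_derive_cos.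
  have dnum : is_derive v 1 (cst 2 * (s * c)) (2 * (2 * c v ^+ 2 - 1)).
    have /is_derive_eq := is_deriveM (is_derive_cst (2 : R) v 1) (is_deriveM ds dc).
    apply; rewrite scaler0 addr0 -[LHS]/(2 * (s v * - s v + c v * c v)).
    by rewrite mulrN -!expr2 c2; ring.
  have dden : is_derive v 1 (cst 1 + cst 2 * (c * c)) (- (4 * s v * c v)).
    have /is_derive_eq := is_deriveD (is_derive_cst (1 : R) v 1)
      (is_deriveM (is_derive_cst (2 : R) v 1) (is_deriveM dc dc)).
    apply; rewrite scaler0 addr0 add0r.
    by rewrite -[LHS]/(2 * (c v * - s v + c v * - s v)); ring.
  have nz : (cst 1 + cst 2 * (c * c)) v != 0 by exact/lt0r_neq0/d0.
  have dt : is_derive v 1 t ((4 * c v ^+ 2 - 1) * 2 / (1 + 2 * c v ^+ 2) ^+ 2).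
    have -> : t = (cst 2 * (s * c)) * (fun x => ((cst 1 + cst 2 * (c * c)) x)^-1).
      apply/funext => x; rewrite /t -[RHS]/(2 * (s x * c x) / (1 + 2 * (c x * c x))).
      by rewrite mulrA expr2.
    have /is_derive_eq := is_deriveM dnum (is_deriveV nz dden).
    apply.
    rewrite -[LHS]/(2 * (s v * c v) * (- (1 + 2 * (c v * c v)) ^- 2 * - (4 * s v * c v)) + (1 + 2 * (c v * c v))^-1 * (2 * (2 * c v ^+ 2 - 1))).
    rewrite -!expr2.
    have := c2 v; move: (d0 v) => /lt0r_neq0 => D0 e.
    transitivity ((8 * s v ^+ 2 * c v ^+ 2 + 2 * (2 * c v ^+ 2 - 1) * (1 + 2 * c v ^+ 2)) / (1 + 2 * c v ^+ 2) ^+ 2).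
      by field.
    by rewrite e; field.
  have dat := is_derive1_comp (is_derive1_atan (t v)) dt.
  have /is_derive_eq := is_deriveD (is_deriveB (is_derive_cst (pi / 2 : R) v 1) (is_derive_id v 1)) dat.
  apply; rewrite /= t2 /GRing.scale /=; field.
  by rewrite !lt0r_neq0.
exists sg; split.
- move=> n; apply: (@CkS _ _ _ n); apply: Ck_is_derive dsg _.
  have [_ Cc] := Ck_sin_cos R n.
  apply: (CkM (@Ck_cst R R R n (-3))); apply: CkV => [v|].
    exact/lt0r_neq0/w0.
  exact: (CkD (@Ck_cst R R R n 1) (CkM (@Ck_cst R R R n 8) (CkM Cc Cc))).
- move=> x y xy; apply: (@ltr0_derive1_decr R sg x y) => //.
  + by move=> z _; rewrite derive1E derive_val mulNr oppr_lt0 divr_gt0.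
  + apply: continuous_subspaceT => z; apply: differentiable_continuous.
    by apply/derivable1_diffP; exact: ex_derive.
- move=> v.
  have wS : 1 + 2 * c (sg v) ^+ 2 = (3 + 6 * c v ^+ 2) / (1 + 8 * c v ^+ 2).
    rewrite /c cosS exprMn exprVn w2 c2 -/(c v); field.
    by rewrite lt0r_neq0.
  suff tS : t (sg v) = t v by rewrite /sg -/(sg v) tS /sg; ring.
  rewrite /t wS /s /c cosS sinS -/(s v) -/(c v).
  have -> : 2 * (3 * c v / w v) * (s v / w v) = 6 * s v * c v / w v ^+ 2.
    by field; rewrite lt0r_neq0.
  rewrite w2; field.
  by rewrite !lt0r_neq0//; have := d0 v; lra.
- by rewrite /sg /t /s sin0 mulr0 !mul0r atan0 subr0 addr0.
- by move=> v; split; [exact: cosS|exact: sinS].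
Qed.

Definition klein_gen (R : realType) (sigma : R -> R) (p q : R * R) : Prop :=
  q = (p.1, p.2 + pi) \/ q = (p.1 + pi / 2, sigma p.2).

(* The orbit relation of a group generated by bijections a and b is the
   equivalence relation generated by p ~ a p and p ~ b p. *)
Definition klein_rel (R : realType) (sigma : R -> R) : rel (R * R) :=
  fun p q => `[< clos_refl_sym_trans _ (klein_gen sigma) p q >].

Lemma klein_rel_refl (R : realType) (sigma : R -> R) :
  reflexive (klein_rel sigma).
Proof. by move=> p; apply/asboolP; exact: rst_refl. Qed.

Lemma klein_rel_sym (R : realType) (sigma : R -> R) :
  symmetric (klein_rel sigma).
Proof.
by move=> p q; apply/idP/idP => /asboolP pq; apply/asboolP; exact: rst_sym.
Qed.

Lemma klein_rel_trans (R : realType) (sigma : R -> R) :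
  transitive (klein_rel sigma).
Proof.
by move=> q p r /asboolP pq /asboolP qr; apply/asboolP; exact: rst_trans qr.
Qed.

Canonical klein_equiv (R : realType) (sigma : R -> R) :=
  EquivRel (klein_rel sigma) (klein_rel_refl sigma) (klein_rel_sym sigma)
    (@klein_rel_trans R sigma).

Definition klein_bottle (R : realType) (sigma : R -> R)
    : quotType (R * R)%type :=
  {eq_quot klein_equiv sigma}.

Definition klein_metric (R : realType) (p X Y : R * R) : R :=
  let w := 1 + 8 * cos p.2 ^+ 2 in
  (9 + w ^+ 2) / w * (X.1 * Y.1 + X.2 * Y.2 / w).

(* Main.v *)
(* Write mu = cos v A + sin v B with A = (e^{3iu}, 0), B = (0, e^{iu}), and put
   w = 1 + 8 cos^2 v = |mu_u|^2, E1 = mu_u, E2 = mu_v. A Gauss map is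
   nu = (sin v iA - 3 cos v iB) / sqrt w, and its derivatives are
   nu_u = 3 w^{-1/2} E2 and nu_v = 3 w^{-3/2} E1. As mu, nu, E1, E2 are
   orthogonal, the Gram identity for the inner product of 2-vectors shows that
   f = mu /\ nu induces the metric (w + 9/w) du^2 + (1 + 9/w^2) dv^2, which is
   g_0 in the same coordinates (u, v).

   In suitable linear coordinates f consists of a, b e^{4iu} and c e^{2iu}, where
   sqrt w (a, b, c) is
   (cos v sin v, 3 cos^2 v + sin^2 v, sin^2 v - 3 cos^2 v).
   Passing from v to sigma v turns w into 9/w, fixes a and b and changes the
   sign of c, so f descends to K. It is injective there: b > 0 and b e^{4iu}
   determine u modulo pi/2, and then a, b, c determine w and e^{2iv}. Since K
   is compact, f is an embedding. *)
Require Import Defs.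
From Stdlib Require Import Relation_Operators.
From mathcomp Require Import all_boot all_order all_algebra.
From mathcomp Require Import all_classical all_reals all_analysis.
From mathcomp Require Import ring lra.
Set Implicit Arguments.
Unset Strict Implicit.
Unset Printing Implicit Defensive.
Import Order.TTheory GRing.Theory Num.Theory.
Import numFieldNormedType.Exports.
Local Open Scope classical_set_scope.
Local Open Scope quotient_scope.
Local Open Scope ring_scope.

(** * Calculus of maps built from linear maps, matrix entries and products *)

(** By linearity the difference quotients coincide before any limit is taken, so derivability and
    directional derivatives both transfer by rewriting. *)
Lemma difference_comp_linear (R : realType) (U V W : normedModType R)
    (l : {linear U -> V}) (f : V -> W) p v :
  (fun h : R => h^-1 *: (((f \o l) \o shift p) (h *: v) - (f \o l) p)) =
  (fun h : R => h^-1 *: ((f \o shift (l p)) (h *: l v) - f (l p))).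
Proof. by apply/funext => h /=; rewrite linearP. Qed.

Lemma derive_comp_linear (R : realType) (U V W : normedModType R)
    (l : {linear U -> V}) (f : V -> W) p v :
  'D_v (f \o l) p = 'D_(l v) f (l p).
Proof. by rewrite /derive difference_comp_linear. Qed.

Lemma derivable_comp_linear (R : realType) (U V W : normedModType R)
    (l : {linear U -> V}) (f : V -> W) p v :
  derivable (f \o l) p v <-> derivable f (l p) (l v).
Proof. by rewrite /derivable difference_comp_linear. Qed.

Lemma Ck_comp_linear (R : realType) (U V W : normedModType R)
    (l : {linear U -> V}) n (f : V -> W) :
  continuous l -> Ck n f -> Ck n (f \o l).
Proof.
move=> cl; elim: n f => [|n IHn] f [cf df]; split=> //;
  try by move=> x; apply: continuous_comp; [exact: cl|exact: cf].
move=> v; have [dv Dv] := df (l v).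
split=> [x|]; first exact/derivable_comp_linear.
have -> : (fun x => 'D_v (f \o l) x) = (fun y => 'D_(l v) f y) \o l.
  by apply/funext => x; rewrite derive_comp_linear.
exact: IHn.
Qed.

(** The matrix norm is the maximum of the finitely many entries, so finitely many entrywise
    neighbourhoods can be intersected. *)
Lemma continuous_mx (R : realType) (T : topologicalType) m n
    (M : T -> 'M[R]_(m, n)) :
  (forall i j, continuous (fun x => M x i j)) -> continuous M.
Proof.
move=> cM x; apply/cvgrPdist_le => /= e e0.
near=> y.
rewrite /Num.Def.normr/= mx_normrE (bigmax_le _ (ltW e0))//= => i _.
rewrite !mxE/=; move: i; near: y; apply: filter_forall => /= i.
exact: (cvgrPdist_le _ _).1 (cM i.1 i.2 x) e e0.
Unshelve. all: by end_near. Qed.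

Lemma is_derive_mx (R : realType) (V : normedModType R) m n
    (M : V -> 'M[R]_(m, n)) (dM : 'M[R]_(m, n)) (x v : V) :
  (forall i j, is_derive x v (fun y => M y i j) (dM i j)) -> is_derive x v M dM.
Proof.
move=> dMij; have dM' : derivable M x v by apply/derivable_mxP.
split=> //; rewrite derive_mx//.
by apply/matrixP => i j; rewrite mxE derive_val.
Qed.

Lemma Ck_mx (R : realType) (V : normedModType R) m n k (M : V -> 'M[R]_(m, n)) :
  (forall i j, Ck k (fun x => M x i j)) -> Ck k M.
Proof.
elim: k M => [|k IHk] M CM; split=> //;
  try by apply: continuous_mx => i j; have [] := CM i j.
move=> v.
have dM x : derivable M x v.
  by apply/derivable_mxP => i j; have [_ /(_ v)[]] := CM i j.
split=> //; apply: IHk => i j.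
have [_ /(_ v)[_]] := CM i j; congr (Ck k _).
by apply/funext => x; rewrite derive_mx// mxE.
Qed.

(** Every entry of mu and nu is a function of u times a function of v, so this single product rule
    covers all of them. *)
Lemma is_derive_fst_snd (R : realType) (g h : R -> R) (dg dh : R)
    (p X : R * R) :
  is_derive p.1 1 g dg -> is_derive p.2 1 h dh ->
  is_derive p X (fun q => g q.1 * h q.2)
    (X.1 * (dg * h p.2) + X.2 * (g p.1 * dh)).
Proof.
move=> Dg Dh.
(* In one variable derivability gives differentiability, so the derivative in direction [v] is [v]
   times the one in direction 1. *)
have scal (f : R -> R) (x v df : R) :
    is_derive x 1 f df -> is_derive x v f (v * df).
  move=> Df; have dif : differentiable f x by exact/derivable1_diffP/ex_derive.
  split; first exact: diff_derivable.
  by rewrite deriveE// deriv1E ?derive1E ?derive_val//; exact: ex_derive.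
have D1 : is_derive p X (g \o fst) (X.1 * dg).
  have [? e] := scal _ _ X.1 _ Dg.
  split; first exact/derivable_comp_linear.
  by rewrite derive_comp_linear e.
have D2 : is_derive p X (h \o snd) (X.2 * dh).
  have [? e] := scal _ _ X.2 _ Dh.
  split; first exact/derivable_comp_linear.
  by rewrite derive_comp_linear e.
apply: is_derive_eq (is_deriveM D1 D2) _.
by rewrite /GRing.scale/=; ring.
Qed.

Lemma Ck_fst_snd (R : realType) n (g h : R -> R) :
  Ck n g -> Ck n h -> Ck n (fun q : R * R => g q.1 * h q.2).
Proof.
move=> Cg Ch.
have C1 : Ck n (g \o (fst : R * R -> R)).
  by apply: Ck_comp_linear => // x; exact: cvg_fst.
have C2 : Ck n (h \o (snd : R * R -> R)).
  by apply: Ck_comp_linear => // x; exact: cvg_snd.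
exact: CkM C1 C2.
Qed.

Lemma Ck_cst_mul (R : realType) n (a : R) (g : R -> R) :
  Ck n g -> Ck n (fun x => a * g x).
Proof. exact/CkM/Ck_cst. Qed.

Lemma CkN (R : realType) n (g : R -> R) : Ck n g -> Ck n (fun x => - g x).
Proof.
move=> /(Ck_cst_mul (-1)); congr (Ck n _).
by apply/funext => x; rewrite mulN1r.
Qed.

(** * Inner products and the wedge product *)

Lemma dotv4E (R : realType) (a b : 'rV[R]_4) :
  dotv a b = a 0 (inord 0) * b 0 (inord 0) + a 0 (inord 1) * b 0 (inord 1)
    + a 0 (inord 2) * b 0 (inord 2) + a 0 (inord 3) * b 0 (inord 3).
Proof.
rewrite /dotv !big_ord_recr big_ord0 /= add0r.
by do !congr (_ + _); congr (a 0 _ * b 0 _); apply/val_inj; rewrite /= inordK.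
Qed.

(** The Gram identity; it reduces the induced metric to inner products of mu, nu, E1 and E2. *)
Lemma dotv_wedge (R : realType) (a b c d : 'rV[R]_4) :
  dotv (wedge a b) (wedge c d) = dotv a c * dotv b d - dotv a d * dotv b c.
Proof.
rewrite !dotv4E /dotv !big_ord_recr big_ord0 /= !mxE /=; ring.
Qed.

Lemma dotvDl (R : realType) n (a b c : 'rV[R]_n) :
  dotv (a + b) c = dotv a c + dotv b c.
Proof.
by rewrite -big_split; apply: eq_bigr => i _; rewrite mxE mulrDl.
Qed.

Lemma dotvC (R : realType) n (a b : 'rV[R]_n) : dotv a b = dotv b a.
Proof. by apply: eq_bigr => i _; rewrite mulrC. Qed.

Lemma dotvDr (R : realType) n (a b c : 'rV[R]_n) :
  dotv c (a + b) = dotv c a + dotv c b.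
Proof. by rewrite dotvC dotvDl !(dotvC c). Qed.

Lemma dotvZl (R : realType) n (x : R) (a b : 'rV[R]_n) :
  dotv (x *: a) b = x * dotv a b.
Proof. by rewrite mulr_sumr; apply: eq_bigr => i _; rewrite mxE mulrA. Qed.

Lemma dotvZr (R : realType) n (x : R) (a b : 'rV[R]_n) :
  dotv b (x *: a) = x * dotv b a.
Proof. by rewrite dotvC dotvZl dotvC. Qed.

(** The Leibniz rule is checked once, on a 2 by 2 minor with arbitrary indices; the six coordinates
    are instances of it. *)
Lemma is_derive_wedge (R : realType) (V : normedModType R)
    (a b : V -> 'rV[R]_4) da db (x v : V) :
  is_derive x v a da -> is_derive x v b db ->
  is_derive x v (fun y => wedge (a y) (b y)) (wedge da (b x) + wedge (a x) db).
Proof.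
move=> Da Db; apply: is_derive_mx => i j; rewrite (ord1 i) {i}.
have coord (f : V -> 'rV[R]_4) df k : is_derive x v f df ->
    is_derive x v (fun y => f y 0 k) (df 0 k).
  move=> [Df <-]; split; first by move/derivable_mxP: Df.
  by rewrite derive_mx// mxE.
have pl k l : is_derive x v (fun y => a y 0 k * b y 0 l - a y 0 l * b y 0 k)
    ((da 0 k * b x 0 l - da 0 l * b x 0 k) +
     (a x 0 k * db 0 l - a x 0 l * db 0 k)).
  apply: is_derive_eq (is_deriveB
    (is_deriveM (coord _ _ k Da) (coord _ _ l Db))
    (is_deriveM (coord _ _ l Da) (coord _ _ k Db))) _.
  by rewrite /GRing.scale/=; ring.
under [X in is_derive _ _ X]eq_fun do rewrite mxE.
rewrite !mxE.
by case: j => [[|[|[|[|[|[|//]]]]]] ?] /=; exact: pl.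
Qed.

Lemma Ck_wedge (R : realType) (V : normedModType R) (a b : V -> 'rV[R]_4) n :
  (forall k, Ck n (fun x => a x 0 k)) -> (forall k, Ck n (fun x => b x 0 k)) ->
  Ck n (fun x => wedge (a x) (b x)).
Proof.
move=> Ca Cb; apply: Ck_mx => i j; rewrite (ord1 i) {i}.
have pl k l : Ck n (fun y => a y 0 k * b y 0 l - a y 0 l * b y 0 k).
  apply: (CkD (CkM (Ca k) (Cb l))).
  have := CkM (@Ck_cst R V R n (-1)) (CkM (Ca l) (Cb k)).
  by congr (Ck n _); apply/funext => y /=; rewrite mulN1r.
under eq_fun do rewrite mxE.
by case: j => [[|[|[|[|[|[|//]]]]]] ?] /=; exact: pl.
Qed.

(** * The normalising factor w^{-1/2} *)

(* The inverse of |mu_u|. *)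
Definition rnorm (R : realType) (v : R) : R :=
  (Num.sqrt (1 + 8 * cos v ^+ 2))^-1.

Lemma sqr_norm_du_gt0 (R : realType) (v : R) : 0 < 1 + 8 * cos v ^+ 2.
Proof. by have := sqr_ge0 (cos v); lra. Qed.

Lemma rnorm_gt0 (R : realType) (v : R) : 0 < rnorm v.
Proof. by rewrite invr_gt0 sqrtr_gt0 sqr_norm_du_gt0. Qed.

Lemma rnormK (R : realType) (v : R) : rnorm v ^+ 2 * (1 + 8 * cos v ^+ 2) = 1.
Proof.
have w0 := sqr_norm_du_gt0 v.
by rewrite /rnorm exprVn sqr_sqrtr ?ltW// mulVf// lt0r_neq0.
Qed.

Lemma is_derive_rnorm (R : realType) (v : R) :
  is_derive v 1 (@rnorm R) (8 * cos v * sin v * rnorm v ^+ 3).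
Proof.
pose w (x : R) := 1 + 8 * cos x ^+ 2.
have w0 : 0 < w v by exact: sqr_norm_du_gt0.
have dw : is_derive v 1 w (- (16 * cos v * sin v)).
  apply: is_derive_eq (is_deriveD (is_derive_cst (1 : R) v 1)
    (is_deriveZ 8 (is_deriveM (is_derive_cos v) (is_derive_cos v)))) _.
  by rewrite /GRing.scale/=; ring.
have ds := @is_derive1_comp _ Num.sqrt w _ _ _ (is_derive1_sqrt w0) dw.
have nz : (Num.sqrt \o w) v != 0 by rewrite /= lt0r_neq0// sqrtr_gt0.
apply: is_derive_eq (is_deriveV nz ds) _.
by rewrite /GRing.scale/= /rnorm -/(w v); field.
Qed.

(** Bootstrapping: the derivative of [rnorm] is a polynomial in [cos], [sin] and [rnorm] itself, so
    class C^n implies class C^{n+1}. *)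
Lemma Ck_rnorm (R : realType) n : Ck n (@rnorm R).
Proof.
elim: n => [|n IHn].
  split=> // x; apply: differentiable_continuous; apply/derivable1_diffP.
  exact: (@ex_derive _ _ _ _ _ _ _ (is_derive_rnorm x)).
apply: (Ck_is_derive (@is_derive_rnorm R)).
have [Cs Cc] := Ck_sin_cos R n.
have := CkM (CkM (CkM (@Ck_cst R R R n 8) Cc) Cs) (CkM IHn (CkM IHn IHn)).
by congr (Ck n _); apply/funext => x /=; rewrite 2!exprS expr1.
Qed.

(** * The torus, its unit normal and their first derivatives *)

Definition lawson31 (R : realType) (p : R * R) : 'rV[R]_4 :=
  \row_(i < 4) nth 0
    [:: cos (3 * p.1) * cos p.2; sin (3 * p.1) * cos p.2;
        cos p.1 * sin p.2; sin p.1 * sin p.2] i.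

Lemma lawson31E (R : realType) : lawson 3 1 = @lawson31 R.
Proof. by apply/funext => p; rewrite /lawson !mul1r. Qed.

(** The header's nu, each entry grouped as a function of [p.1] times a function of [p.2] to fit
    [is_derive_fst_snd] and [Ck_fst_snd]. *)
Definition gauss31 (R : realType) (p : R * R) : 'rV[R]_4 :=
  \row_(i < 4) nth 0
    [:: - sin (3 * p.1) * (sin p.2 * rnorm p.2);
        cos (3 * p.1) * (sin p.2 * rnorm p.2);
        sin p.1 * (3 * (cos p.2 * rnorm p.2));
        - cos p.1 * (3 * (cos p.2 * rnorm p.2))] i.

(** E1 of the header; with E2, which is [lawson31_dv], it also expresses the derivatives of
    [gauss31]. *)
Definition lawson31_du (R : realType) (p : R * R) : 'rV[R]_4 :=
  \row_(i < 4) nth 0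
    [:: - sin (3 * p.1) * (3 * cos p.2); cos (3 * p.1) * (3 * cos p.2);
        - sin p.1 * sin p.2; cos p.1 * sin p.2] i.

Definition lawson31_dv (R : realType) (p : R * R) : 'rV[R]_4 :=
  \row_(i < 4) nth 0
    [:: - cos (3 * p.1) * sin p.2; - sin (3 * p.1) * sin p.2;
        cos p.1 * cos p.2; sin p.1 * cos p.2] i.

Lemma is_derive_sin3 (R : realType) (x : R) :
  is_derive x 1 (fun u : R => sin (3 * u)) (3 * cos (3 * x)).
Proof.
have D : is_derive x 1 ( *%R 3 : R -> R) 3.
  have D3 : is_derive x 1 ( *%R 3 : R -> R) _ :=
    is_deriveZ 3 (is_derive_id x (1 : R)).
  by apply: is_derive_eq D3 _; exact: mulr1.
have Ds := @is_derive1_comp _ sin ( *%R 3) x _ _ (is_derive_sin _) D.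
by apply: is_derive_eq Ds _; rewrite mulrC.
Qed.

Lemma is_derive_cos3 (R : realType) (x : R) :
  is_derive x 1 (fun u : R => cos (3 * u)) (- (3 * sin (3 * x))).
Proof.
have D : is_derive x 1 ( *%R 3 : R -> R) 3.
  have D3 : is_derive x 1 ( *%R 3 : R -> R) _ :=
    is_deriveZ 3 (is_derive_id x (1 : R)).
  by apply: is_derive_eq D3 _; exact: mulr1.
have Dc := @is_derive1_comp _ cos ( *%R 3) x _ _ (is_derive_cos _) D.
apply: is_derive_eq Dc _.
by rewrite mulNr mulrC.
Qed.

Lemma is_derive_lawson31 (R : realType) (p X : R * R) :
  is_derive p X (@lawson31 R) (X.1 *: lawson31_du p + X.2 *: lawson31_dv p).
Proof.
apply: is_derive_mx => i j; rewrite (ord1 i) {i}.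
under [X in is_derive _ _ X]eq_fun do rewrite mxE.
rewrite !mxE.
have dc3 := @is_derive_cos3 R p.1; have ds3 := @is_derive_sin3 R p.1.
have dc (x : R) := is_derive_cos x; have ds (x : R) := is_derive_sin x.
case: j => [[|[|[|[|//]]]] ?] /=.
- apply: is_derive_eq (is_derive_fst_snd X dc3 (dc _)) _; ring.
- apply: is_derive_eq (is_derive_fst_snd X ds3 (dc _)) _; ring.
- apply: is_derive_eq (is_derive_fst_snd X (dc _) (ds _)) _; ring.
- apply: is_derive_eq (is_derive_fst_snd X (ds _) (ds _)) _; ring.
Qed.

Lemma is_derive_gauss31 (R : realType) (p X : R * R) :
  is_derive p X (@gauss31 R)
    ((X.1 * (3 * rnorm p.2)) *: lawson31_dv p +
     (X.2 * (3 * rnorm p.2 ^+ 3)) *: lawson31_du p).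
Proof.
apply: is_derive_mx => i j; rewrite (ord1 i) {i}.
under [X in is_derive _ _ X]eq_fun do rewrite mxE.
rewrite !mxE.
have dc3 := @is_derive_cos3 R p.1; have ds3 := @is_derive_sin3 R p.1.
have dns3 : is_derive p.1 1 (fun u : R => - sin (3 * u)) _ := is_deriveN ds3.
have dc (x : R) := is_derive_cos x; have ds (x : R) := is_derive_sin x.
have dnc : is_derive p.1 1 (fun u : R => - cos u) _ := is_deriveN (dc p.1).
(* Trading r for r^3 w gives every term of the derivatives the factor r^3; what remains follows from
   sin^2 = 1 - cos^2. *)
have rE : rnorm p.2 = rnorm p.2 ^+ 3 * (1 + 8 * cos p.2 ^+ 2).
  by rewrite exprS -mulrA rnormK mulr1.
have dsr : is_derive p.2 1 (fun v : R => sin v * rnorm v)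
    (9 * cos p.2 * rnorm p.2 ^+ 3).
  apply: is_derive_eq (is_deriveM (ds _) (is_derive_rnorm p.2)) _.
  rewrite /GRing.scale/= [X in _ + X * _]rE; have := sin2cos2 p.2.
  by move: (sin _) (cos _) (rnorm _) => s c r e; ring: e.
have dcr : is_derive p.2 1 (fun v : R => 3 * (cos v * rnorm v))
    (- (3 * sin p.2 * rnorm p.2 ^+ 3)).
  apply: is_derive_eq
    (is_deriveZ 3 (is_deriveM (dc _) (is_derive_rnorm p.2))) _.
  rewrite /GRing.scale/= [X in _ * (_ + X * _)]rE; have := sin2cos2 p.2.
  by move: (sin _) (cos _) (rnorm _) => s c r e; ring: e.
case: j => [[|[|[|[|//]]]] ?] /=.
- apply: is_derive_eq (is_derive_fst_snd X dns3 dsr) _; ring.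
- apply: is_derive_eq (is_derive_fst_snd X dc3 dsr) _; ring.
- apply: is_derive_eq (is_derive_fst_snd X (ds _) dcr) _; ring.
- apply: is_derive_eq (is_derive_fst_snd X dnc dcr) _; ring.
Qed.

Lemma lawson31_frame (R : realType) (p : R * R) :
  [/\ dotv (lawson31 p) (lawson31 p) = 1, dotv (gauss31 p) (gauss31 p) = 1
    & dotv (gauss31 p) (lawson31 p) = 0] /\
  [/\ dotv (lawson31 p) (lawson31_du p) = 0,
      dotv (lawson31 p) (lawson31_dv p) = 0,
      dotv (gauss31 p) (lawson31_du p) = 0
    & dotv (gauss31 p) (lawson31_dv p) = 0] /\
  [/\ dotv (lawson31_du p) (lawson31_du p) = 1 + 8 * cos p.2 ^+ 2,
      dotv (lawson31_dv p) (lawson31_dv p) = 1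
    & dotv (lawson31_du p) (lawson31_dv p) = 0].
Proof.
have e3 := sin2cos2 (3 * p.1); have e1 := sin2cos2 p.1.
have e := sin2cos2 p.2; have eK := rnormK p.2.
rewrite !dotv4E !mxE !inordK//=.
move: eK e e1 e3; move: (rnorm _) (sin p.2) (cos p.2) => r s c.
move: (sin _) (cos _) (sin _) (cos _) => s1 c1 s3 c3 eK e e1 e3.
split; last split; split; try by ring: e e1 e3.
(* What remains is |nu|^2 = 1, the only relation involving the defining equation of [rnorm]. *)
by rewrite -[RHS]eK; ring: e e1 e3.
Qed.

Lemma Ck_sin3_cos3 (R : realType) n :
  Ck n (fun u : R => sin (3 * u)) /\ Ck n (fun u : R => cos (3 * u)).
Proof.
have [Cs Cc] := Ck_sin_cos R n.
have ct : continuous (3%R \*: (idfun : R -> R^o)) by exact: scaler_continuous.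
have Cl (f : R -> R) : Ck n f -> Ck n (fun u : R => f (3 * u)).
  exact: (Ck_comp_linear ct).
by split; exact: Cl.
Qed.

Lemma Ck_lawson31 (R : realType) n k : Ck n (fun p : R * R => lawson31 p 0 k).
Proof.
have [Cs Cc] := Ck_sin_cos R n; have [Cs3 Cc3] := Ck_sin3_cos3 R n.
under eq_fun do rewrite mxE.
case: k => [[|[|[|[|//]]]] ?] /=.
- exact: (Ck_fst_snd Cc3 Cc).
- exact: (Ck_fst_snd Cs3 Cc).
- exact: (Ck_fst_snd Cc Cs).
- exact: (Ck_fst_snd Cs Cs).
Qed.

Lemma Ck_gauss31 (R : realType) n k : Ck n (fun p : R * R => gauss31 p 0 k).
Proof.
have [Cs Cc] := Ck_sin_cos R n; have [Cs3 Cc3] := Ck_sin3_cos3 R n.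
have Csr := CkM Cs (@Ck_rnorm R n).
have Ccr := Ck_cst_mul 3 (CkM Cc (@Ck_rnorm R n)).
have Cns3 := CkN Cs3; have Cnc := CkN Cc.
under eq_fun do rewrite mxE.
case: k => [[|[|[|[|//]]]] ?] /=.
- exact: (Ck_fst_snd Cns3 Csr).
- exact: (Ck_fst_snd Cc3 Csr).
- exact: (Ck_fst_snd Cs Ccr).
- exact: (Ck_fst_snd Cnc Ccr).
Qed.

(** * The bipolar map and its induced metric *)

Definition bipolar31 (R : realType) (p : R * R) : 'rV[R]_6 :=
  wedge (lawson31 p) (gauss31 p).

Lemma bipolar31_metric (R : realType) (p X Y : R * R) :
  dotv ('D_X (@bipolar31 R) p) ('D_Y (@bipolar31 R) p) = klein_metric p X Y.
Proof.
have D Z : is_derive p Z (@bipolar31 R) _ :=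
  is_derive_wedge (is_derive_lawson31 p Z) (is_derive_gauss31 p Z).
rewrite !derive_val /klein_metric.
have [[mm nn nm] [[mu mv nu nv] [uu vv uv]]] := lawson31_frame p.
have vu : dotv (lawson31_dv p) (lawson31_du p) = 0 by rewrite dotvC.
have mn : dotv (lawson31 p) (gauss31 p) = 0 by rewrite dotvC.
have um : dotv (lawson31_du p) (lawson31 p) = 0 by rewrite dotvC.
have vm : dotv (lawson31_dv p) (lawson31 p) = 0 by rewrite dotvC.
have un : dotv (lawson31_du p) (gauss31 p) = 0 by rewrite dotvC.
have vn : dotv (lawson31_dv p) (gauss31 p) = 0 by rewrite dotvC.
rewrite !(dotvDl, dotvDr, dotv_wedge, dotvZl, dotvZr).
rewrite mm nn nm mn mu mv nu nv um vm un vn uu vv uv vu.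
have w0 : 1 + 8 * cos p.2 ^+ 2 != 0 by rewrite lt0r_neq0// sqr_norm_du_gt0.
have rE : rnorm p.2 ^+ 2 = (1 + 8 * cos p.2 ^+ 2)^-1.
  by apply: (mulIf w0); rewrite rnormK mulVf.
have r6 : rnorm p.2 ^+ 6 = (1 + 8 * cos p.2 ^+ 2) ^- 3.
  by rewrite (exprM _ 2 3) rE exprVn.
move: (rnorm p.2) (1 + _) w0 rE r6 => r w w0 rE r6.
(* The partial derivatives are E1 /\ nu + 3 r mu /\ E2 and E2 /\ nu + 3 r^3 mu /\ E1; they are
   orthogonal, and these are their squared norms. *)
transitivity (X.1 * Y.1 * (w + 9 * r ^+ 2) + X.2 * Y.2 * (1 + 9 * r ^+ 6 * w)).
  by ring.
by rewrite rE r6; field.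
Qed.

(** * Periods of the torus, and the Gauss map property *)

(** Comparing values at (0, 0) and (0, pi/2) gives cos 3w_1 cos w_2 = 1 and cos w_1 cos w_2 = 1, so
    all three cosines equal a common sign [e]. *)
Lemma lawson31_period (R : realType) (w : R * R) :
  (forall p : R * R, lawson31 (p + w) = lawson31 p) ->
  exists2 e : R, e ^+ 2 = 1 &
    [/\ sin w.1 = 0, cos w.1 = e, sin w.2 = 0, cos w.2 = e
      & sin (3 * w.1) = 0 /\ cos (3 * w.1) = e].
Proof.
move=> per.
have at0 i : lawson31 w 0 i = lawson31 (0 : R * R) 0 i.
  by rewrite -{1}[w]add0r per.
have at1 i := congr1 (fun M : 'rV[R]_4 => M 0 i) (per (0, pi / 2)).
have a0 : cos (3 * w.1) * cos w.2 = 1.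
  by have := at0 (inord 0); rewrite !mxE inordK//= mulr0 cos0 mulr1.
have a1 : cos w.1 * cos w.2 = 1.
  have := at1 (inord 2); rewrite !mxE inordK//= add0r cos0 sin_pihalf mulr1.
  by rewrite addrC sinDpihalf.
have unit (x y : R) : cos x * cos y = 1 ->
    [/\ cos x ^+ 2 = 1, sin x = 0 & cos x = cos y].
  move=> xy.
  (* Here sin^2 x = - cos^2 x sin^2 y, which is both nonnegative and nonpositive. *)
  have s0 : sin x = 0.
    apply/eqP; rewrite -sqrf_eq0 eq_le sqr_ge0 andbT sin2cos2.
    have -> : 1 - cos x ^+ 2 = - (cos x ^+ 2 * (1 - cos y ^+ 2)).
      by rewrite mulrBr -exprMn xy; ring.
    by rewrite oppr_le0 -sin2cos2 mulr_ge0 ?sqr_ge0.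
  have c1 : cos x ^+ 2 = 1 by rewrite cos2sin2 s0; ring.
  by split=> //; rewrite -[LHS]mulr1 -xy mulrA -expr2 c1 mul1r.
have [_ s3 c3] := unit _ _ a0; have [_ s1 c1] := unit _ _ a1.
have [e2 s2 _] := unit _ _ (etrans (mulrC _ _) a1).
by exists (cos w.2).
Qed.

Lemma gauss31_is_gauss_map (R : realType) :
  is_gauss_map (lawson 3 1) (@gauss31 R).
Proof.
rewrite lawson31E; split.
- by move=> n; apply: Ck_mx => i j; rewrite (ord1 i); exact: Ck_gauss31.
- move=> w /lawson31_period[e e2 [s1 c1 s2 c2 [s3 c3]]] p.
  (* A period multiplies the u-factor and the v-factor of each entry by [e], and e^2 = 1; [rnorm]
     depends only on cos^2. *)
  have cE : cos (p + w).2 = e * cos p.2 by rewrite /= cosD c2 s2; ring.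
  have rE : rnorm (p + w).2 = rnorm p.2.
    by rewrite /rnorm cE exprMn e2 mul1r.
  apply/rowP => i; rewrite !mxE rE cE.
  have -> : sin (p + w).2 = e * sin p.2 by rewrite /= sinD c2 s2; ring.
  have -> : cos (3 * (p + w).1) = e * cos (3 * p.1).
    by rewrite /= mulrDr cosD c3 s3; ring.
  have -> : sin (3 * (p + w).1) = e * sin (3 * p.1).
    by rewrite /= mulrDr sinD c3 s3; ring.
  have -> : cos (p + w).1 = e * cos p.1 by rewrite /= cosD c1 s1; ring.
  have -> : sin (p + w).1 = e * sin p.1 by rewrite /= sinD c1 s1; ring.
  by case: i => [[|[|[|[|//]]]] ?] /=; ring: e2.
- move=> p; have [[_ nn nm] [[_ _ nu nv] _]] := lawson31_frame p.
  split=> // X; have [_ ->] := is_derive_lawson31 p X.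
  by rewrite dotvDr !dotvZr nu nv !mulr0 addr0.
Qed.

Lemma smooth_bipolar31 (R : realType) : smooth (@bipolar31 R).
Proof.
by move=> n; apply: Ck_wedge; [exact: Ck_lawson31|exact: Ck_gauss31].
Qed.

(** * Explicit coordinates of the bipolar map *)

(* a, b, c of the header. *)
Definition bip_a (R : realType) (v : R) : R := cos v * sin v * rnorm v.

Definition bip_b (R : realType) (v : R) : R :=
  (3 * cos v ^+ 2 + sin v ^+ 2) * rnorm v.

Definition bip_c (R : realType) (v : R) : R :=
  (sin v ^+ 2 - 3 * cos v ^+ 2) * rnorm v.

(** The addition formulas for 4u = 3u + u and 2u = 3u - u. Sums and differences of the middle four
    entries isolate b e^{4iu} and c e^{2iu}. *)
Lemma bipolar31E (R : realType) (p : R * R) :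
  bipolar31 p = \row_(i < 6) nth 0
    [:: bip_a p.2;
        (sin (4 * p.1) * bip_b p.2 + sin (2 * p.1) * bip_c p.2) / 2;
        (cos (2 * p.1) * bip_c p.2 - cos (4 * p.1) * bip_b p.2) / 2;
        - (cos (2 * p.1) * bip_c p.2 + cos (4 * p.1) * bip_b p.2) / 2;
        (sin (2 * p.1) * bip_c p.2 - sin (4 * p.1) * bip_b p.2) / 2;
        - 3 * bip_a p.2] i.
Proof.
have -> : 4 * p.1 = 3 * p.1 + p.1 by ring.
have -> : 2 * p.1 = 3 * p.1 - p.1 by ring.
rewrite sinB sinD cosB cosD /bip_a /bip_b /bip_c.
have e3 := sin2cos2 (3 * p.1); have e1 := sin2cos2 p.1.
apply/rowP => i; rewrite !mxE.
move: i => [[|[|[|[|[|[|//]]]]]] ?] /=; rewrite ?mxE ?inordK//=.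
- by ring: e3.
- by field.
- by field.
- by field.
- by field.
- by ring: e1.
Qed.

Lemma bipolar31_eq (R : realType) (p q : R * R) :
  bipolar31 p = bipolar31 q ->
  [/\ bip_a p.2 = bip_a q.2,
      sin (4 * p.1) * bip_b p.2 = sin (4 * q.1) * bip_b q.2,
      cos (4 * p.1) * bip_b p.2 = cos (4 * q.1) * bip_b q.2,
      sin (2 * p.1) * bip_c p.2 = sin (2 * q.1) * bip_c q.2
    & cos (2 * p.1) * bip_c p.2 = cos (2 * q.1) * bip_c q.2].
Proof.
rewrite !bipolar31E => pq.
have co i := congr1 (fun M : 'rV[R]_6 => M 0 i) pq.
have := co (inord 0); have := co (inord 1); have := co (inord 2).
have := co (inord 3); have := co (inord 4); rewrite !mxE !inordK//=.
by move=> e4 e3 e2 e1 e0; split=> //; lra.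
Qed.

Lemma bip_b_gt0 (R : realType) (v : R) : 0 < bip_b v.
Proof.
apply: mulr_gt0 (rnorm_gt0 _); rewrite sin2cos2.
by have := sqr_ge0 (cos v); lra.
Qed.

(** * Integer shifts and the solutions of cos x = 1 *)

Lemma periodicz (U V : zmodType) (f : U -> V) (T : U) :
  periodic f T -> forall (k : int) a, f (a + T *~ k) = f a.
Proof.
move=> fT [n|n] a; first exact: periodicn.
by rewrite -[in LHS](periodicn fT n.+1) NegzE mulrNz pmulrn subrK.
Qed.

Lemma ex_shift_itv (R : realType) (T x : R) : 0 < T ->
  exists k : int, 0 <= x + T *~ k < T.
Proof.
move=> T0; exists (- Num.floor (x / T)).
rewrite mulrNz -mulrzl subr_ge0 ltrBlDr.
have := floor_itv (x / T); rewrite ler_pdivlMr// ltr_pdivrMr//.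
by rewrite intrD mulrDl mul1r addrC => /andP[-> ->].
Qed.

(** After reduction to [0, 2 pi), the double-angle formula gives sin (y/2) = 0, while [sin] is
    positive on (0, pi). *)
Lemma cos_eq1 (R : realType) (x : R) : cos x = 1 ->
  exists k : int, x = pi *+ 2 *~ k.
Proof.
move=> cx; have pi0 := pi_gt0 R.
have [k] := @ex_shift_itv R (pi *+ 2) x (mulrn_wgt0 2 pi0).
set y := x + _; move=> /andP[y0 y2].
have cy : cos y = 1 by rewrite /y periodicz//; exact: cosD2pi.
suff y00 : y = 0.
  by exists (- k); apply/eqP; rewrite mulrNz -addr_eq0; exact/eqP.
have sy : sin (y / 2) = 0.
  apply/eqP; rewrite -sqrf_eq0.
  have := cosD (y / 2) (y / 2); rewrite -splitr cy -!expr2 cos2sin2 => e.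
  by apply/eqP; lra.
apply/eqP/negP => /negP yn0.
have : 0 < sin (y / 2).
  have yp : 0 < y by rewrite lt_neqAle eq_sym yn0.
  by apply: sin_gt0_pi; rewrite divr_gt0//= ltr_pdivrMr// mulr_natr.
by rewrite sy ltxx. 
Qed.

(** * The Klein bottle relation and the fibres of the bipolar map *)

Lemma klein_shiftv (R : realType) (sigma : R -> R) (k : int) (u v : R) :
  klein_rel sigma (u, v) (u, v + pi *~ k).
Proof.
have step w : klein_rel sigma (u, w) (u, w + pi).
  by apply/asboolP/rst_step; left.
elim/int_ind: k => [|n IHn|n IHn]; first by rewrite mulr0z addr0 klein_rel_refl.
  apply: klein_rel_trans IHn _.
  by rewrite intS mulrzDr mulr1z addrCA addrC; exact: step.
apply: klein_rel_trans IHn _.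
rewrite klein_rel_sym (_ : v + pi *~ - n%:Z = v + pi *~ - n.+1%:Z + pi)//.
by rewrite -addrA intS opprD mulrzDr mulrN1z addrAC addNr add0r.
Qed.

(** The point [v'] is [v] or [sigma v] according to the parity of [k]; steps down also apply
    [sigma], which is its own inverse. *)
Lemma klein_shiftu (R : realType) (sigma : R -> R)
    (hsigma : is_klein_sigma sigma) (k : int) (u v : R) :
  exists v', klein_rel sigma (u, v) (u + pi / 2 *~ k, v').
Proof.
have [_ _ invo _ _] := hsigma.
have step u' w : klein_rel sigma (u', w) (u' + pi / 2, sigma w).
  by apply/asboolP/rst_step; right.
elim/int_ind: k => [|n [v' IHn]|n [v' IHn]].
- by exists v; rewrite mulr0z addr0 klein_rel_refl.
- exists (sigma v'); apply: klein_rel_trans IHn _.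
  by rewrite intS mulrzDr mulr1z addrCA addrC; exact: step.
- exists (sigma v'); apply: klein_rel_trans IHn _.
  rewrite klein_rel_sym.
  rewrite (_ : u + pi / 2 *~ - n%:Z = u + pi / 2 *~ - n.+1%:Z + pi / 2).
    by rewrite -{2}(invo v'); exact: step.
  by rewrite -addrA intS opprD mulrzDr mulrN1z addrAC addNr add0r.
Qed.

Lemma bipolar31_klein (R : realType) (sigma : R -> R)
    (hsigma : is_klein_sigma sigma) (p q : R * R) :
  klein_rel sigma p q -> bipolar31 p = bipolar31 q.
Proof.
move=> /asboolP; elim=> {p q} [p q|//|p q _ -> //|p q s _ -> _ -> //].
case=> ->.
  have [ea eb ec] : [/\ bip_a (p.2 + pi) = bip_a p.2,
      bip_b (p.2 + pi) = bip_b p.2 & bip_c (p.2 + pi) = bip_c p.2].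
    have rE : rnorm (p.2 + pi) = rnorm p.2 by rewrite /rnorm cosDpi sqrrN.
    by rewrite /bip_a /bip_b /bip_c rE cosDpi sinDpi mulrNN !sqrrN.
  by rewrite !bipolar31E /= ea eb ec.
have [_ _ _ _ /(_ p.2)[cS sS]] := hsigma.
have rp := rnorm_gt0 p.2; have rK := rnormK p.2.
have s2 := sin2cos2 p.2.
rewrite -/(rnorm p.2) in cS sS.
(* This is the passage from w to 9/w: 1 + 8 sin^2 v / w = 9 / w. *)
have rE : rnorm (sigma p.2) = (3 * rnorm p.2)^-1.
  rewrite [LHS]/rnorm cS; congr (_^-1).
  rewrite -[RHS]ger0_norm ?mulr_ge0 ?ltW// -sqrtr_sqr; congr Num.sqrt.
  by rewrite !exprMn s2; lra.
have [ea eb ec] : [/\ bip_a (sigma p.2) = bip_a p.2,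
    bip_b (sigma p.2) = bip_b p.2 & bip_c (sigma p.2) = - bip_c p.2].
  by rewrite /bip_a /bip_b /bip_c rE cS sS; split; field; rewrite lt0r_neq0.
rewrite !bipolar31E /= ea eb ec.
(* The angle 4u moves by a full turn and 2u by a half turn, whose sign cancels that of c. *)
have -> : 4 * (p.1 + pi / 2) = 4 * p.1 + pi *+ 2 by field.
have -> : 2 * (p.1 + pi / 2) = 2 * p.1 + pi by field.
by rewrite sinD2pi cosD2pi sinDpi cosDpi !mulrNN.
Qed.

Lemma bipolar31_inj (R : realType) (sigma : R -> R)
    (hsigma : is_klein_sigma sigma) (p q : R * R) :
  bipolar31 p = bipolar31 q -> klein_rel sigma p q.
Proof.
(* First step: b is the modulus of b e^{4iu}, and dividing by it determines 4u modulo 2 pi. *)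
wlog : p / exists k : int, q.1 = p.1 + pi / 2 *~ k.
  move=> wlogk pq.
  have [_ eS eC _ _] := bipolar31_eq pq.
  have eb : bip_b p.2 = bip_b q.2.
    apply/eqP; rewrite -(eqrXn2 (ltn0Sn 1)) ?ltW ?bip_b_gt0//; apply/eqP.
    have sqrE (t z : R) : z ^+ 2 = (cos t * z) ^+ 2 + (sin t * z) ^+ 2.
      by rewrite !exprMn -mulrDl cos2Dsin2 mul1r.
    by rewrite (sqrE (4 * p.1)) eS eC -sqrE.
  have b0 : bip_b q.2 != 0 by rewrite lt0r_neq0// bip_b_gt0.
  rewrite eb in eS eC; move/(mulIf b0): eS => eS; move/(mulIf b0): eC => eC.
  have [] := @cos_eq1 R (4 * q.1 - 4 * p.1).
    by rewrite cosB eS eC -!expr2 cos2Dsin2.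
  move=> k kE; apply: wlogk => //; exists k.
  have -> : pi / 2 *~ k = (pi *+ 2 *~ k) / 4 :> R.
    by rewrite -[LHS]mulrzr -(mulrzr (pi *+ 2)); field.
  by rewrite -kE; field.
(* Second step: [p] is replaced by an equivalent point above the same u, which has the same
   image. *)
wlog eu : p / p.1 = q.1.
  move=> wlogu [k kE] pq.
  have [v' pv'] := klein_shiftu hsigma k p.1 p.2.
  rewrite -kE -surjective_pairing in pv'.
  apply: (klein_rel_trans pv'); apply: wlogu => //=.
    by exists 0; rewrite mulr0z addr0.
  by rewrite -(bipolar31_klein hsigma pv').
move=> _ pq.
have [ea eS eC eS2 eC2] := bipolar31_eq pq.
(* A common rotation by [x] is undone by multiplying by cos x and sin x and adding. *)
have comb (x X Y : R) : sin x * X = sin x * Y -> cos x * X = cos x * Y -> X = Y.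
  have mulE Z : Z = cos x * (cos x * Z) + sin x * (sin x * Z).
    by rewrite !mulrA -!expr2 -mulrDl cos2Dsin2 mul1r.
  by move=> es ec; rewrite (mulE X) es ec -mulE.
rewrite eu in eS eC eS2 eC2.
have eb := comb _ _ _ eS eC; have ec := comb _ _ _ eS2 eC2.
have sp := sin2cos2 p.2; have sq := sin2cos2 q.2.
move: ea eb ec; rewrite /bip_a /bip_b /bip_c sp sq => ea eb ec.
(* With sin^2 eliminated, 2 b + c = 3 r. *)
have er : rnorm p.2 = rnorm q.2 by lra.
have r0 : rnorm q.2 != 0 by rewrite lt0r_neq0// rnorm_gt0.
rewrite er in ea eb ec.
move/(mulIf r0): ea => ea; move/(mulIf r0): eb => eb.
have e2 : cos p.2 ^+ 2 = cos q.2 ^+ 2 by lra.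
(* Equal cos sin and equal cos^2 mean equal sin 2v and cos 2v. *)
have [] := @cos_eq1 R (2 * q.2 - 2 * p.2).
  have -> : 2 * q.2 - 2 * p.2 = (q.2 + q.2) - (p.2 + p.2) by ring.
  rewrite cosB !sinD !cosD -!expr2 sp sq.
  have -> : sin p.2 * cos p.2 = cos q.2 * sin q.2 by rewrite mulrC.
  rewrite e2 [cos p.2 * sin p.2]ea.
  have -> : sin q.2 * cos q.2 = cos q.2 * sin q.2 by rewrite mulrC.
  by ring: sq.
move=> k kE.
have -> : q = (p.1, p.2 + pi *~ k).
  rewrite eu [q in LHS]surjective_pairing; congr (_, _).
  have -> : pi *~ k = (pi *+ 2 *~ k) / 2 :> R.
    by rewrite -[LHS]mulrzr -(mulrzr (pi *+ 2)); field.
  by rewrite -kE; field.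
by rewrite [p in klein_rel _ p]surjective_pairing; exact: klein_shiftv.
Qed.

(** * Compactness and the isometry *)

(** The coordinate u is reduced first, since this may change v; shifting v then leaves u fixed. The
    box is closed so that it is compact. *)
Lemma klein_box (R : realType) (sigma : R -> R)
    (hsigma : is_klein_sigma sigma) (p : R * R) :
  exists2 q, (`[0, pi / 2] `*` `[0, pi]) q & klein_rel sigma p q.
Proof.
have pi0 := pi_gt0 R; have pi20 : 0 < pi / 2 :> R by rewrite divr_gt0.
have [k /andP[k0 k1]] := ex_shift_itv p.1 pi20.
have [v' pv'] := klein_shiftu hsigma k p.1 p.2.
have [l /andP[l0 l1]] := ex_shift_itv v' pi0.
exists (p.1 + pi / 2 *~ k, v' + pi *~ l).
  by split; rewrite /= in_itv/= ?k0 ?l0 ltW.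
rewrite -surjective_pairing in pv'.
by apply: (klein_rel_trans pv'); exact: klein_shiftv.
Qed.

Lemma klein_isometry (R : realType) (sigma : R -> R)
    (hsigma : is_klein_sigma sigma) :
  is_isometry_onto (@klein_metric R) (range (@bipolar31 R))
    (fun x : klein_bottle sigma => bipolar31 (repr x)).
Proof.
have piE (p : R * R) :
    bipolar31 (repr (\pi_(klein_bottle sigma) p)) = bipolar31 p.
  apply: (bipolar31_klein hsigma).
  by have /eqmodP := reprK (\pi_(klein_bottle sigma) p).
have FE : (fun p : R * R => bipolar31 (repr (\pi_(klein_bottle sigma) p))) =
    @bipolar31 R by exact/funext.
have Finj : injective (fun x : klein_bottle sigma => bipolar31 (repr x)).
  move=> x y /(bipolar31_inj hsigma) xy.
  by rewrite -[x]reprK -[y]reprK; exact/eqmodP.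
split=> //.
- by rewrite FE; exact: smooth_bipolar31.
- by move=> p X Y; rewrite FE; exact: bipolar31_metric.
- apply/seteqP; split => y [x _ <-]; first by exists (repr x).
  by exists (\pi_(klein_bottle sigma) x) => //; exact: piE.
- move=> U oU.
  pose P : set (R * R) := \pi_(klein_bottle sigma) @^-1` U.
  pose B : set (R * R) := `[0, pi / 2] `*` `[0, pi].
  have oP : open P by exact: oU.
  have cK : compact (@bipolar31 R @` (B `&` ~` P)).
    apply: continuous_compact.
      apply: continuous_subspaceT; by have [] := @smooth_bipolar31 R 0%N.
    apply: compact_closedI; last exact: open_closedC.
    by apply: compact_setX; exact: segment_compact.
  (* The part of the box outside the preimage [P] of [U] has compact, hence closed, image; V is its
     complement. Injectivity keeps the image of [U] inside V. *)
  exists (~` (@bipolar31 R @` (B `&` ~` P))).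
    by apply: closed_openC; apply: compact_closed => //; exact: norm_hausdorff.
  apply/seteqP; split => y.
    move=> [x Ux <-]; split; first by exists (repr x).
    move=> [q [_ nPq] qx]; apply: nPq; rewrite /P /=.
    by rewrite -(@Finj x (\pi_(klein_bottle sigma) q))// piE.
  move=> [[p _ <-] npK].
  exists (\pi_(klein_bottle sigma) p); last exact: piE.
  (* If the class of [p] were outside [U], its representative in the box would put the image of [p]
     in the removed compact set. *)
  apply: contrapT => nU; apply: npK.
  have [q Bq pq] := klein_box hsigma p.
  exists q; last by rewrite (bipolar31_klein hsigma pq).
  split=> //; rewrite /P /=.
  suff -> : \pi_(klein_bottle sigma) q = \pi_(klein_bottle sigma) p by [].
  by apply/esym/eqmodP.
Qed.
Theorem theorem1p4p1 (R : realType) (sigma : R -> R)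
    (hsigma : is_klein_sigma sigma) :
  is_bipolar_surface (klein_bottle sigma) (@klein_metric R) (lawson 3 1).
Proof.
exists (@gauss31 R); first exact: gauss31_is_gauss_map.
exists (fun x : klein_bottle sigma => bipolar31 (repr x)).
by rewrite /bipolar_image lawson31E; exact: klein_isometry.
Qed.
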